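(* Let $\Phi=\{\varphi_n\}_{n=1}^N\subseteq\mathbb{R}^M$ and let $\sqrt{\mathcal{A}}\colon\mathbb{R}^M/\{\pm1\}\rightarrow\mathbb{R}^N$ be defined by $(\sqrt{\mathcal{A}}(x))(n):=|\langle x,\varphi_n\rangle|$. The upper Lipschitz constant for $\sqrt{\mathcal{A}}$, i.e., the smallest $\beta$ such that $\|\sqrt{\mathcal{A}}(x)-\sqrt{\mathcal{A}}(y)\|\leq\beta\operatorname{d}(x,y)$ for all $x,y\in\mathbb{R}^M/\{\pm1\}$, is $\beta=\|\Phi^*\|_2$.
   Context: $\mathbb{R}^M/\{\pm1\}$ denotes $\mathbb{R}^M$ with $x$ and $-x$ identified, equipped with the metric $\operatorname{d}(x,y):=\min\{\|x-y\|,\|x+y\|\}$, where $\|\cdot\|$ is the Euclidean norm. $\Phi$ is also regarded as the $M\times N$ matrix whose $n$th column is $\varphi_n$; $\Phi^*$ is its transpose and $\|\Phi^*\|_2$ is its operator (spectral) norm. *)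

(* Defs.v *)
From HB Require Import structures.
From mathcomp Require Import all_boot all_order all_algebra.
From mathcomp Require Import generic_quotient.
From mathcomp Require Import all_classical all_reals.

Set Implicit Arguments.
Unset Strict Implicit.
Unset Printing Implicit Defensive.

Import Order.TTheory GRing.Theory Num.Theory.
Local Open Scope quotient_scope.
Local Open Scope classical_set_scope.
Local Open Scope ring_scope.

Section Euclidean.
Context {R : realType}.

Definition dot n (x y : 'cV[R]_n) : R := \sum_(i < n) x i 0 * y i 0.

(* Not the canonical norm `|x| of matrices, which is the max norm. *)
Definition enorm n (x : 'cV[R]_n) : R := Num.sqrt (dot x x).

Definition opnorm m n (A : 'M[R]_(m, n)) : R :=
  sup [set enorm (A *m x) | x in [set x : 'cV[R]_n | enorm x <= 1]].

Definition synthesis M N (phi : 'I_N -> 'cV[R]_M) : 'M[R]_(M, N) :=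
  \matrix_(i < M, j < N) phi j i 0.

Lemma dotNl n (x y : 'cV[R]_n) : dot (- x) y = - dot x y.
Proof.
by rewrite /dot -sumrN; apply: eq_bigr => i _; rewrite !mxE mulNr.
Qed.

Lemma enormN n (x : 'cV[R]_n) : enorm (- x) = enorm x.
Proof.
by rewrite /enorm /dot; congr Num.sqrt; apply: eq_bigr => i _; rewrite !mxE mulrNN.
Qed.

End Euclidean.

Section ModuloSign.
Context {R : realType} {M : nat}.

Definition pm_eq (x y : 'cV[R]_M) : bool := (x == y) || (x == - y).

Lemma pm_eq_refl : reflexive pm_eq.
Proof. by move=> x; rewrite /pm_eq eqxx. Qed.

Lemma pm_eq_sym : symmetric pm_eq.
Proof. by move=> x y; rewrite /pm_eq eq_sym -eqr_oppLR (eq_sym (- x)). Qed.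

Lemma pm_eq_trans : transitive pm_eq.
Proof.
move=> y x z /orP[] /eqP-> /orP[] /eqP->;
  by rewrite /pm_eq ?opprK eqxx ?orbT.
Qed.

Canonical pm_eq_equiv := EquivRel pm_eq pm_eq_refl pm_eq_sym pm_eq_trans.

End ModuloSign.

Definition pmspace (R : realType) (M : nat) : Type := {eq_quot (@pm_eq R M)}.
HB.instance Definition _ (R : realType) (M : nat) :=
  EqQuotient.on (pmspace R M).
HB.instance Definition _ (R : realType) (M : nat) := Choice.on (pmspace R M).

Section OnQuotient.
Context {R : realType} {M : nat}.
Implicit Types x y : 'cV[R]_M.

Lemma pm_reprP x :
  repr (\pi_(pmspace R M) x) = x \/ repr (\pi_(pmspace R M) x) = - x.
Proof.
have /eqP := reprK (\pi_(pmspace R M) x).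
by rewrite eqmodE => /orP[] /eqP; [left | right].
Qed.

Definition pm_dist_rep x y : R := Num.min (enorm (x - y)) (enorm (x + y)).

Definition pm_dist := lift_fun2 (pmspace R M) pm_dist_rep.

Lemma pi_pm_dist : {mono \pi_(pmspace R M) : x y / pm_dist_rep x y >-> pm_dist x y}.
Proof.
move=> x y; unlock pm_dist; rewrite /pm_dist_rep.
have e1 : enorm (- x - y) = enorm (x + y) by rewrite -enormN opprD !opprK.
have e2 : enorm (- x + y) = enorm (x - y) by rewrite -enormN opprD !opprK.
by case: (pm_reprP x) => ->; case: (pm_reprP y) => ->;
  rewrite ?opprK ?e1 ?e2 // minC.
Qed.
Canonical pi_pm_dist_mono := PiMono2 pi_pm_dist.

Context {N : nat}.
Variable phi : 'I_N -> 'cV[R]_M.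

Definition sqrtA_rep x : 'cV[R]_N := \col_(n < N) `|dot x (phi n)|.

Definition sqrtA := lift_fun1 (pmspace R M) sqrtA_rep.

Lemma pi_sqrtA : {mono \pi_(pmspace R M) : x / sqrtA_rep x >-> sqrtA x}.
Proof.
move=> x; unlock sqrtA; case: (pm_reprP x) => -> //.
by apply/colP => i; rewrite !mxE dotNl normrN.
Qed.
Canonical pi_sqrtA_mono := PiMono1 pi_sqrtA.

(* Lipschitz constants are nonnegative by convention.  The condition matters
   only for M = 0: the distance then vanishes identically, and every real
   number would satisfy the inequality. *)
Definition upper_lipschitz_bound (beta : R) : Prop :=
  0 <= beta /\
  forall x y : pmspace R M,
    enorm (sqrtA x - sqrtA y) <= beta * pm_dist x y.

Definition is_upper_lipschitz_constant (beta : R) : Prop :=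
  upper_lipschitz_bound beta /\
  lbound [set b | upper_lipschitz_bound b] beta.

End OnQuotient.

(* Main.v *)
(** Since [||a| - |b|| <= |a - b|] and [||a| - |b|| <= |a + b|], the difference
    of the two intensity vectors is dominated entrywise by both [Phi^T (x - y)]
    and [Phi^T (x + y)], which gives the upper bound.  Optimality follows by
    taking [y = 0], where both sides reduce to [Phi^T x] and [x]. *)

Require Import Defs.
From mathcomp Require Import all_boot all_order all_algebra.
From mathcomp Require Import generic_quotient.
From mathcomp Require Import all_classical all_reals.

Import Order.TTheory GRing.Theory Num.Theory.
Local Open Scope ring_scope.

Section EuclideanNorm.
Set Implicit Arguments.
Unset Strict Implicit.
Context {R : realType}.

Lemma enorm_ge0 n (x : 'cV[R]_n) : 0 <= enorm x.
Proof. exact: sqrtr_ge0. Qed.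

Lemma enormZ n (a : R) (x : 'cV[R]_n) : enorm (a *: x) = `|a| * enorm x.
Proof.
have -> : enorm (a *: x) = Num.sqrt (a ^+ 2 * dot x x).
  congr Num.sqrt; rewrite /dot mulr_sumr; apply: eq_bigr => i _.
  by rewrite !mxE mulrACA expr2.
by rewrite sqrtrM ?sqr_ge0// sqrtr_sqr.
Qed.

Lemma enorm0 n : enorm (0 : 'cV[R]_n) = 0.
Proof. by rewrite -(scale0r 0) enormZ normr0 mul0r. Qed.

Lemma ler_enorm n (x y : 'cV[R]_n) :
  (forall i, `|x i 0| <= `|y i 0|) -> enorm x <= enorm y.
Proof.
move=> xy; apply: ler_wsqrtr; apply: ler_sum => i _.
by rewrite -!expr2 -[x i 0 ^+ 2]real_normK ?num_real//
  -[y i 0 ^+ 2]real_normK ?num_real// lerXn2r ?nnegrE// xy.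
Qed.

Lemma ler_abs_enorm n (x : 'cV[R]_n) i : `|x i 0| <= enorm x.
Proof.
rewrite -sqrtr_sqr; apply: ler_wsqrtr.
rewrite /dot (bigD1 i)//= expr2 lerDl; apply: sumr_ge0 => j _.
by rewrite -expr2 sqr_ge0.
Qed.

Lemma enorm_eq0 n (x : 'cV[R]_n) : enorm x = 0 -> x = 0.
Proof.
move=> x0; apply/colP => i; rewrite mxE; apply/eqP.
by rewrite -normr_le0 -x0 ler_abs_enorm.
Qed.

Lemma dotBl n (x y z : 'cV[R]_n) : dot (x - y) z = dot x z - dot y z.
Proof.
by rewrite /dot -sumrB; apply: eq_bigr => i _; rewrite !mxE mulrBl.
Qed.

End EuclideanNorm.

Section OperatorNorm.
Set Implicit Arguments.
Unset Strict Implicit.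
Context {R : realType}.
Variables (m n : nat) (A : 'M[R]_(m, n)).

(** [sup] is a genuine least upper bound only for a nonempty set bounded above, so both facts about
    [opnorm] used later, that it bounds the image and that it is least, rest on this. *)
Lemma opnorm_has_sup :
  has_sup [set enorm (A *m x) | x in [set x : 'cV[R]_n | enorm x <= 1]]%classic.
Proof.
split; first by exists (enorm (A *m 0)), 0 => //=; rewrite enorm0 ler01.
(* On the unit ball every coordinate of [x] has absolute value at most 1, so the vector of absolute
   row sums dominates [A *m x] entrywise. *)
exists (enorm (\col_i \sum_j `|A i j|)) => _ [x /= x1 <-].
apply: ler_enorm => i; rewrite !mxE.
rewrite [leRHS]ger0_norm; last exact: sumr_ge0.
apply: le_trans (ler_norm_sum _ _ _) _; apply: ler_sum => j _.
by rewrite normrM ler_piMr// (le_trans (ler_abs_enorm _ _)).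
Qed.

Lemma opnorm_ge x : enorm x <= 1 -> enorm (A *m x) <= opnorm A.
Proof. by move=> x1; apply: ub_le_sup; [case: opnorm_has_sup|exists x]. Qed.

Lemma opnorm_ge0 : 0 <= opnorm A.
Proof.
by apply: le_trans (@opnorm_ge 0 _); rewrite ?enorm_ge0// enorm0 ler01.
Qed.

(** By homogeneity: for nonzero [x], scaling by the inverse of [enorm x] gives a unit vector, to
    which [opnorm_ge] applies. *)
Lemma enorm_mulmx_le x : enorm (A *m x) <= opnorm A * enorm x.
Proof.
have [/enorm_eq0 ->|x0] := eqVneq (enorm x) 0.
  by rewrite mulmx0 !enorm0 mulr0.
have xgt0 : 0 < enorm x by rewrite lt0r x0 enorm_ge0.
have absV : `|(enorm x)^-1| = (enorm x)^-1 by rewrite ger0_norm// invr_ge0 ltW.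
rewrite -ler_pdivrMr// mulrC -absV -enormZ scalemxAr.
by apply: opnorm_ge; rewrite enormZ absV mulVf.
Qed.

End OperatorNorm.

Section SqrtIntensity.
Set Implicit Arguments.
Unset Strict Implicit.
Context {R : realType} {M N : nat}.
Variable phi : 'I_N -> 'cV[R]_M.

Lemma synthesis_trE (x : 'cV[R]_M) n : ((synthesis phi)^T *m x) n 0 = dot x (phi n).
Proof. by rewrite !mxE; apply: eq_bigr => i _; rewrite !mxE mulrC. Qed.

(** The reverse triangle inequality in each entry, with linearity of [dot] in its first argument. *)
Lemma enorm_sqrtA_rep_subl (x y : 'cV[R]_M) :
  enorm (sqrtA_rep phi x - sqrtA_rep phi y) <= enorm ((synthesis phi)^T *m (x - y)).
Proof.
by apply: ler_enorm => n; rewrite synthesis_trE dotBl !mxE ler_dist_dist.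
Qed.

Lemma sqrtA_repN (x : 'cV[R]_M) : sqrtA_rep phi (- x) = sqrtA_rep phi x.
Proof. by apply/colP => n; rewrite !mxE dotNl normrN. Qed.

Lemma sqrtA_rep0 : sqrtA_rep phi 0 = 0.
Proof.
by apply/colP => n; rewrite !mxE -synthesis_trE mulmx0 mxE normr0.
Qed.

Lemma enorm_sqrtA_rep (x : 'cV[R]_M) :
  enorm (sqrtA_rep phi x) = enorm ((synthesis phi)^T *m x).
Proof.
by apply/le_anti/andP; split; apply: ler_enorm => n;
  rewrite synthesis_trE mxE normr_id.
Qed.

End SqrtIntensity.

Theorem lemma16 (R : realType) (M N : nat) (phi : 'I_N -> 'cV[R]_M) :
  is_upper_lipschitz_constant phi (opnorm (synthesis phi)^T).
Proof.
split; [split; first exact: opnorm_ge0|].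
- move=> p q; rewrite -[p]reprK -[q]reprK !pi_sqrtA pi_pm_dist.
  set x := repr p; set y := repr q.
  rewrite /pm_dist_rep; case: (leP (enorm (x - y))) => _.
  + exact: le_trans (enorm_sqrtA_rep_subl _ _ _) (enorm_mulmx_le _ _).
  (* Here the minimum is [enorm (x + y)]. Replacing [y] by [- y] leaves [sqrtA_rep] unchanged and
     turns the sum into a difference, as in the first case. *)
  + rewrite -(sqrtA_repN phi y) -[y in leRHS]opprK.
    exact: le_trans (enorm_sqrtA_rep_subl _ _ _) (enorm_mulmx_le _ _).
- move=> b [b0 bP]; apply: ge_sup; first by case: (opnorm_has_sup (synthesis phi)^T).
  move=> _ [x /= x1 <-].
  (* Against the class of 0, both candidates for the distance equal [enorm x], so the minimum
     collapses. *)
  have := bP (\pi_(pmspace R M) x)%qT (\pi_(pmspace R M) 0)%qT.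
  rewrite !pi_sqrtA pi_pm_dist /pm_dist_rep sqrtA_rep0 !subr0 addr0 minxx.
  rewrite enorm_sqrtA_rep => /le_trans; apply.
  (* [b * enorm x <= b] combines [enorm x <= 1] with the sign condition [0 <= b]. *)
  by rewrite ler_piMr.
Qed.
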